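(* Let $\mathcal H$ be a separable Hilbert space, and let $\mathcal F=\{f_i\}_{i\in I}$ and $\mathcal G=\{g_i\}_{i\in I}$ be two woven frames for $\mathcal H$ with universal frame bounds $A,B$. Let $T_{\mathcal G}$ be the synthesis operator of $\mathcal G$. If $H=\{h_i\}_{i\in I}$ is a frame sequence in $\mathcal H$ with synthesis operator $T_H$ such that $$(\|T_{\mathcal G}\|+\|T_H\|)\,\|T_{\mathcal G}-T_H\|<A,$$ then $\mathcal F$ and $H$ are woven.
   Context: The index set $I$ is finite or countably infinite, and $\sigma^c=I\setminus\sigma$. A family $\{f_i\}_{i\in I}$ in a Hilbert space $\mathcal H$ is a frame for $\mathcal H$ with frame bounds $A,B>0$ if $A\|f\|^2\le\sum_{i\in I}|\langle f,f_i\rangle|^2\le B\|f\|^2$ for all $f\in\mathcal H$; it is a frame sequence in $\mathcal H$ if it is a frame for its closed linear span. Two frame sequences (in particular, two frames, or a frame and a frame sequence) $\{f_i\}_{i\in I}$ and $\{g_i\}_{i\in I}$ in $\mathcal H$ are woven if for every $\sigma\subset I$ the family (weaving) $\{f_i\}_{i\in\sigma}\cup\{g_i\}_{i\in\sigma^c}$ (counted with multiplicity) is a frame for $\mathcal H$. Constants $A,B$ are universal frame bounds if they are frame bounds for every weaving simultaneously. The synthesis operator of a family $\{g_i\}_{i\in I}$ is $T_{\mathcal G}:\ell^2(I)\to\mathcal H$, $T_{\mathcal G}(\{c_i\})=\sum_{i\in I}c_ig_i$; it is well-defined and bounded for Bessel sequences, in particular for frame sequences. *)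

(* Defs.v *)
From HB Require Import structures.
From mathcomp Require Import all_boot all_order all_algebra complex.
From mathcomp Require Import all_classical all_reals all_analysis.
From mathcomp Require summability.

Set Implicit Arguments.
Unset Strict Implicit.
Unset Printing Implicit Defensive.

Import Order.TTheory GRing.Theory Num.Theory numFieldNormedType.Exports.

Local Open Scope classical_set_scope.
Local Open Scope ring_scope.

(* Hilbert spaces may be real or complex: every notion below is parameterized
   by the kind of its scalars. *)
Variant scalar_kind := RealScalars | ComplexScalars.

Section Scalars.
Variable R : realType.

Definition scalars (k : scalar_kind) : numFieldType :=
  match k with
  | RealScalars => (R : numFieldType)
  | ComplexScalars => (R[i] : numFieldType)
  end.

Definition conjugate (k : scalar_kind) : scalars k -> scalars k :=
  match k return scalars k -> scalars k with
  | RealScalars => fun x : R => x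
  | ComplexScalars => fun z : R[i] => conjc z
  end.

Fact conjugate_is_zmod_morphism k : zmod_morphism (@conjugate k).
Proof. by case: k => // x y /=; rewrite rmorphB. Qed.

Fact conjugate_is_monoid_morphism k : monoid_morphism (@conjugate k).
Proof.
case: k; split=> [|x y] //=; first exact: (@rmorph1 _ _ (@conjc R)).
by rewrite rmorphM.
Qed.

HB.instance Definition _ k := GRing.isZmodMorphism.Build
  (scalars k) (scalars k) (@conjugate k) (@conjugate_is_zmod_morphism k).
HB.instance Definition _ k := GRing.isMonoidMorphism.Build
  (scalars k) (scalars k) (@conjugate k) (@conjugate_is_monoid_morphism k).

(* The norm of a complex number lives in R[i]; [modulus] is the corresponding
   element of R. *)
Definition modulus (k : scalar_kind) : scalars k -> R :=
  match k return scalars k -> R with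
  | RealScalars => fun x : R => `|x|
  | ComplexScalars => fun z : R[i] => Normc.normc z
  end.

End Scalars.

(* A dot product is linear in its first argument, conjugate-linear in the
   second one. *)
Record hilbertSpace (R : realType) (k : scalar_kind) := HilbertSpace {
  hilbert_carrier :> completeNormedModType (scalars R k);
  inner : {dot hilbert_carrier for @conjugate R k};
  inner_norm : forall x : hilbert_carrier, `|x| ^+ 2 = inner x x }.

Definition separable (T : topologicalType) :=
  exists2 D : set T, countable D & dense D.

Section Frames.
Variables (R : realType) (k : scalar_kind) (H : hilbertSpace R k).
Variable I : countType.
Implicit Types (f g : I -> H) (c : I -> scalars R k) (W : set H) (A B : R).

Definition hnorm (x : H) : R := modulus `|x|.

Definition frame_bounds_on W f A B :=
  [/\ 0 < A, 0 < B & forall x, W x ->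
    ((A * hnorm x ^+ 2)%:E
       <= \esum_(i in [set: I]) (modulus (inner H x (f i)) ^+ 2)%:E
       <= (B * hnorm x ^+ 2)%:E)%E].

Definition frame_for W f :=
  (forall i, W (f i)) /\ exists A B, frame_bounds_on W f A B.

Definition frame_bounds := frame_bounds_on [set: H].

Definition frame := frame_for [set: H].

Definition closed_span f : set H :=
  closure [set v | exists (s : seq I) c, v = \sum_(i <- s) c i *: f i].

Definition frame_sequence f := frame_for (closed_span f) f.

(* The disjoint union of f restricted to sigma and g restricted to its
   complement, again indexed by I. *)
Definition weaving (sigma : set I) f g : I -> H :=
  fun i => if i \in sigma then f i else g i.

Definition woven f g :=
  [/\ frame_sequence f, frame_sequence g
    & forall sigma : set I, frame (weaving sigma f g)].

Definition universal_frame_bounds f g A B :=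
  forall sigma : set I, frame_bounds (weaving sigma f g) A B.

Definition l2_sum c : \bar R := \esum_(i in [set: I]) (modulus (c i) ^+ 2)%:E.

Definition l2 : set (I -> scalars R k) := [set c | (l2_sum c < +oo)%E].

Definition l2norm c : R := Num.sqrt (fine (l2_sum c)).

(* The sum is the limit of the net of finite partial sums; the value is
   meaningful on [l2] for Bessel families, the only case considered. *)
Definition synthesis g : (I -> scalars R k) -> H :=
  fun c => summability.sum (fun i => c i *: g i).

(* Operator norm of a map defined on [l2]. *)
Definition opnorm (T : (I -> scalars R k) -> H) : \bar R :=
  ereal_sup [set (hnorm (T c))%:E | c in [set c | l2 c /\ l2norm c <= 1]].

End Frames.

(* Main.v *)
Require Import Defs.
From mathcomp Require Import all_boot all_order all_algebra complex.
From mathcomp Require Import all_classical all_reals all_analysis.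
From mathcomp Require Import finmap.
From mathcomp Require summability.
From mathcomp Require Import ring lra.

(** The lower frame bound of a weaving of F and H is that of the corresponding
    weaving of F and G, up to a loss that the hypothesis makes smaller than A.

    Fix a vector x and a finite set s of indices, and let a and b be the
    families of coefficients <x, g_i> and <x, h_i>, cut down to s.  Write D for
    T_G - T_H.  The identity
      a conj(a) - b conj(b) = a' + conj(b'),
      where a' = conj(a) (a - b) and b' = conj(b) (a - b),
    sums over s to
      |a|^2 - |b|^2 = <x, D a> + conj <x, D b>
    ([energy_perturbation]), hence
      |a|^2 - |b|^2 <= |x| |D| (|a| + |b|).
    Moreover |a|^2 = <x, T_G a> <= |x| |T_G| |a| gives |a| <= |T_G| |x|, and
    likewise |b| <= |T_H| |x| ([energy_le_opnorm]).  Therefore replacing G by H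
    outside any sigma costs at most (|T_G| + |T_H|) |D| |x|^2, uniformly in s
    ([energy_sub_le_opnorm], [weaving_energy_le]), and the weaving of F and H
    has the positive lower bound A - (|T_G| + |T_H|) |D|.

    Only finitely supported coefficient families occur in this argument, on
    which synthesis is a finite sum; the bounds on them are uniform in s and
    pass to the supremum that defines the sum over all indices.

    For the upper bound, a frame sequence is a Bessel family of the whole space
    and not only of its closed span ([bessel_of_closed_span]); upper bounds of
    F and H then add up. *)

Set Implicit Arguments.
Unset Strict Implicit.
Unset Printing Implicit Defensive.
Import Order.TTheory GRing.Theory Num.Theory numFieldNormedType.Exports.
Local Open Scope classical_set_scope.
Local Open Scope ring_scope.

(** * Scalars *)

Section Modulus.
Variables (R : realType) (k : scalar_kind).
Implicit Types x y : scalars R k.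

Lemma modulus_ge0 x : 0 <= modulus x.
Proof. by case: k x => [x|[a b]] /=; [exact: normr_ge0|exact: sqrtr_ge0]. Qed.

Lemma modulus0 : modulus (0 : scalars R k) = 0.
Proof. by case: k => /=; [exact: normr0|exact: Normc.normc0]. Qed.

Lemma modulus_eq0 x : modulus x = 0 -> x = 0.
Proof. by case: k x => x /=; [move/normr0P/eqP|exact: Normc.eq0_normc]. Qed.

Lemma modulusM x y : modulus (x * y) = modulus x * modulus y.
Proof. by case: k x y => x y /=; [exact: normrM|exact: Normc.normcM]. Qed.

Lemma modulusX2 x : modulus (x ^+ 2) = modulus x ^+ 2.
Proof. by rewrite !expr2 modulusM. Qed.

Lemma modulus_normr x : modulus `|x| = modulus x.
Proof.
case: k x => x /=; first exact: normr_id.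
by case: x => a b /=; rewrite expr0n addr0 sqrtr_sqr ger0_norm // sqrtr_ge0.
Qed.

Lemma modulus_conjugate x : modulus (conjugate x) = modulus x.
Proof. by case: k x => [//|[a b]] /=; rewrite sqrrN. Qed.

Lemma ler_modulus x y : (`|x| <= `|y|) = (modulus x <= modulus y).
Proof.
case: k x y => x y //; case: x y => [a b] [c d] /=.
by rewrite -[RHS]lecR.
Qed.

Lemma ler_modulusD x y : modulus (x + y) <= modulus x + modulus y.
Proof.
by case: k x y => x y /=; [exact: ler_normD|exact: (@le_normcD R x y)].
Qed.

Lemma modulusD_ge0 x y : 0 <= x -> 0 <= y ->
  modulus (x + y) = modulus x + modulus y.
Proof.
case: k x y => [x y x0 y0|[a b] [c d]] /=; first by rewrite !ger0_norm ?addr_ge0.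
rewrite !lecE /= => /andP[/eqP-> a0] /andP[/eqP-> c0].
by rewrite !addr0 expr0n !addr0 !sqrtr_sqr !ger0_norm ?addr_ge0.
Qed.

Lemma modulus_sum (I : Type) (s : seq I) (F : I -> scalars R k) :
  (forall i, 0 <= F i) ->
  modulus (\sum_(i <- s) F i) = \sum_(i <- s) modulus (F i).
Proof.
move=> F0; elim: s => [|i s IH]; first by rewrite !big_nil modulus0.
by rewrite !big_cons modulusD_ge0 ?sumr_ge0 // IH.
Qed.

Lemma ler_modulus_sum (I : Type) (s : seq I) (F : I -> scalars R k) :
  modulus (\sum_(i <- s) F i) <= \sum_(i <- s) modulus (F i).
Proof.
elim: s => [|i s IH]; first by rewrite !big_nil modulus0.
by rewrite !big_cons (le_trans (ler_modulusD _ _)) // lerD2l.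
Qed.

Lemma conjugateK x : conjugate (conjugate x) = x.
Proof. by case: k x => x //=; exact: conjcK. Qed.

Lemma mul_conjugate x : x * conjugate x = `|x| ^+ 2.
Proof.
case: k x => x /=; first by rewrite real_normK ?num_real // expr2.
by rewrite sqr_normc.
Qed.

(** Real rescalings of vectors of H have to be made by elements of the scalar
    field, which may be complex. *)
Lemma modulus_onto (r : R) :
  0 <= r -> exists a : scalars R k, modulus a = r.
Proof.
case: k => r0; first by exists r; rewrite /= ger0_norm.
by exists (r%:C)%C; rewrite /= expr0n addr0 sqrtr_sqr ger0_norm.
Qed.

End Modulus.

(** * Inner products *)

Section Inner.
Variables (R : realType) (k : scalar_kind) (H : hilbertSpace R k).
Implicit Types x y z : H.
Local Notation "''[' x , y ]" := (inner H x y).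

Lemma innerC x y : '[x, y] = conjugate '[y, x].
Proof. by rewrite hermC /= expr0 mul1r. Qed.

Lemma innerDl x y z : '[x + y, z] = '[x, z] + '[y, z].
Proof. exact: linearDl. Qed.

Lemma innerZl a x y : '[a *: x, y] = a * '[x, y].
Proof. exact: linearZl_LR. Qed.

Lemma innerBr x y z : '[x, y - z] = '[x, y] - '[x, z].
Proof. exact: linearBr. Qed.

Lemma innerZr a x y : '[x, a *: y] = conjugate a * '[x, y].
Proof. exact: linearZr_LR. Qed.

Lemma inner_sumr (I : Type) (s : seq I) x (F : I -> H) :
  '[x, \sum_(i <- s) F i] = \sum_(i <- s) '[x, F i].
Proof. by rewrite linear_sumr. Qed.

Lemma hnorm_ge0 x : 0 <= hnorm x.
Proof. exact: modulus_ge0. Qed.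

Lemma hnorm_sqr x : hnorm x ^+ 2 = modulus '[x, x].
Proof. by rewrite -inner_norm modulusX2. Qed.

(** Positivity of the square norm of <y, y> x - <x, y> y, a form of the
    projection of x off the line of y that involves no division. *)
Lemma CauchySchwarz_hnorm x y : modulus '[x, y] <= hnorm x * hnorm y.
Proof.
have [->|y0] := eqVneq y 0.
  by rewrite [inner H x 0]linear0r modulus0 mulr_ge0 ?hnorm_ge0.
pose p := '[x, y]; pose n := `|y| ^+ 2.
have n_gt0 : 0 < n by rewrite exprn_gt0 // normr_gt0.
have conj_n : conjugate n = n by rewrite /n inner_norm -innerC.
have : 0 <= `|n *: x - p *: y| ^+ 2 by rewrite exprn_ge0.
have -> : `|n *: x - p *: y| ^+ 2 = n * (n * `|x| ^+ 2 - `|p| ^+ 2).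
  rewrite (inner_norm (n *: x - p *: y)) innerBr !innerZr conj_n -scaleNr.
  rewrite !innerDl !innerZl -!inner_norm -/n -/p (innerC y x) -/p.
  by rewrite -(mul_conjugate p); ring.
rewrite pmulr_rge0 // subr_ge0 /n -exprMn => le2.
have : `|p| <= `| `|x| * `|y| |.
  by rewrite normrM !normr_id mulrC -(@ler_pXn2r _ 2) ?nnegrE ?mulr_ge0.
by rewrite ler_modulus modulusM.
Qed.

End Inner.

(** * Sums over all indices and over finitely many *)

Section Esum.
Variables (R : realType) (I : choiceType).

Lemma esum_fin_le (a : I -> R) (M : \bar R) :
  (forall s, uniq s -> ((\sum_(i <- s) a i)%:E <= M)%E) ->
  (\esum_(i in [set: I]) (a i)%:E <= M)%E.
Proof.
move=> leM; apply: ge_ereal_sup => _ [X [finX _] <-].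
by rewrite fsbig_finite //= sumEFin; apply: leM.
Qed.

Lemma fin_le_esum (a : I -> R) (s : seq I) : uniq s ->
  ((\sum_(i <- s) a i)%:E <= \esum_(i in [set: I]) (a i)%:E)%E.
Proof.
move=> us; apply: esum_ge; exists [set` s].
  by split=> //; exact: finite_seq.
by rewrite -fsbig_seq // sumEFin.
Qed.

End Esum.

(** * Synthesis operators on finitely supported families *)

Section Frames.
Variables (R : realType) (k : scalar_kind) (H : hilbertSpace R k).
Variables (I : countType).
Implicit Types (f g : I -> H) (c : I -> scalars R k) (s : seq I) (x y : H).
Local Notation "''[' x , y ]" := (inner H x y).

Definition supported_on s c := forall i, i \notin s -> c i = 0.

(** The net of partial sums is constant beyond s, so its limit is a finite sum
    for every family g, Bessel or not. *)
Lemma synthesis_supported g s c : uniq s -> supported_on s c ->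
  synthesis g c = \sum_(i <- s) c i *: g i.
Proof.
move=> us cs; apply: norm_lim_near_cst.
  exact: summability.totally_filter.
exists [fset i in s]%fset => //= X /fsubsetP sX.
rewrite /summability.partial_sum.
rewrite -(big_seq_fsetE _ X predT (fun i => c i *: g i)) /=.
rewrite [LHS](bigID (mem s)) /= [X in _ + X]big1 ?addr0; last first.
  by move=> i /cs ->; rewrite scale0r.
rewrite -big_filter; apply: perm_big; apply: uniq_perm => //.
  by rewrite filter_uniq // fset_uniq.
move=> i; rewrite mem_filter; apply/andP/idP => [[]//|si]; split=> //.
by apply: sX; rewrite inE.
Qed.

Lemma l2_sum_supported s c : uniq s -> supported_on s c ->
  l2_sum c = (\sum_(i <- s) modulus (c i) ^+ 2)%:E.
Proof.
move=> us cs; apply/eqP; rewrite eq_le fin_le_esum // andbT.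
apply: esum_fin_le => r ur; rewrite lee_fin (bigID (mem s)) /=.
rewrite [X in _ + X]big1 ?addr0; last first.
  by move=> i /cs ->; rewrite modulus0 expr0n.
rewrite -big_filter [leRHS](bigID (mem r)) /= -[X in X <= _]addr0.
rewrite lerD ?sumr_ge0 //.
  rewrite -[leRHS]big_filter le_eqVlt (perm_big [seq i <- s | i \in r]) ?eqxx //.
  apply: uniq_perm; rewrite ?filter_uniq // => i.
  by rewrite !mem_filter andbC.
by move=> i _; rewrite exprn_ge0 ?modulus_ge0.
Qed.

Lemma opnorm_ge0 (T : (I -> scalars R k) -> H) : (0 <= opnorm T)%E.
Proof.
have l20 : @l2_sum R k I (fun=> 0) = 0%E.
  by apply: esum1 => i _; rewrite modulus0 expr0n.
apply: (@le_trans _ _ (hnorm (T (fun=> 0)))%:E).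
  by rewrite lee_fin hnorm_ge0.
apply: ereal_sup_ubound; exists (fun=> 0) => //; split.
  by rewrite /l2 /= l20.
by rewrite /l2norm l20 sqrtr0.
Qed.

(** Rescaling c to the unit sphere.  Homogeneity is asked only along the line of
    c, since a synthesis operator need not be linear outside [l2]. *)
Lemma opnorm_bound (T : (I -> scalars R k) -> H) s c :
  uniq s -> supported_on s c -> (forall a, T (fun i => a * c i) = a *: T c) ->
  ((hnorm (T c))%:E
     <= opnorm T * (Num.sqrt (\sum_(i <- s) modulus (c i) ^+ 2))%:E)%E.
Proof.
move=> us cs Tc; set S := \sum_(i <- s) _.
have c_ge0 i : 0 <= modulus (c i) ^+ 2 by rewrite exprn_ge0 ?modulus_ge0.
have : 0 <= S by exact: sumr_ge0.
rewrite le_eqVlt => /predU1P[S0|S_gt0].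
  (* Here c vanishes, and T c = T (0 c) = 0 T c. *)
  have c0 i : c i = 0.
    have [si|/cs//] := boolP (i \in s).
    apply/modulus_eq0/eqP; rewrite -sqrf_eq0.
    have : S == 0 by rewrite -S0.
    by rewrite psumr_eq0 // => /allP/(_ i si).
  have -> : T c = 0.
    rewrite -[RHS](scale0r (T c)) -Tc; congr T.
    by apply/funext => i; rewrite c0 mulr0.
  by rewrite -S0 sqrtr0 mule0 lee_fin /hnorm normr0 modulus0.
have N_gt0 : 0 < Num.sqrt S by rewrite sqrtr_gt0.
have Ni_ge0 : 0 <= (Num.sqrt S)^-1 by rewrite invr_ge0 ltW.
have [a aN] := @modulus_onto R k _ Ni_ge0.
have l21 : l2_sum (fun i => a * c i) = 1%E.
  rewrite (@l2_sum_supported s) //; last by move=> i /cs ->; rewrite mulr0.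
  under eq_bigr do rewrite modulusM exprMn.
  by rewrite -mulr_sumr aN exprVn sqr_sqrtr ?(ltW S_gt0) // mulVf // gt_eqF.
have : ((hnorm (T (fun i => a * c i)))%:E <= opnorm T)%E.
  apply: ereal_sup_ubound; exists (fun i => a * c i) => //; split.
    by rewrite /l2 /= l21 ltry.
  by rewrite /l2norm l21 /= sqrtr1.
rewrite Tc /hnorm normrZ modulusM modulus_normr aN -/(hnorm (T c)).
by rewrite mulrC EFinM lee_pdivrMr.
Qed.

(** * Energy of a vector on finitely many indices *)

Definition analysis_on g x s i := if i \in s then '[x, g i] else 0.

Definition energy g x s := \sum_(i <- s) modulus '[x, g i] ^+ 2.

Lemma energy_ge0 g x s : 0 <= energy g x s.
Proof. by apply: sumr_ge0 => i _; rewrite exprn_ge0 ?modulus_ge0. Qed.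

Lemma analysis_on_supported g x s : supported_on s (analysis_on g x s).
Proof. by move=> i /negPf si; rewrite /analysis_on si. Qed.

Lemma synthesis_analysis_on f g x s : uniq s ->
  synthesis f (analysis_on g x s) = \sum_(i <- s) '[x, g i] *: f i.
Proof.
move=> us; rewrite (synthesis_supported _ us (@analysis_on_supported g x s)).
by apply: eq_big_seq => i si; rewrite /analysis_on si.
Qed.

Lemma synthesisZ f s c a : uniq s -> supported_on s c ->
  synthesis f (fun i => a * c i) = a *: synthesis f c.
Proof.
move=> us cs; rewrite !(@synthesis_supported _ s) //; last first.
  by move=> i /cs ->; rewrite mulr0.
by rewrite scaler_sumr; apply: eq_bigr => i _; rewrite scalerA.
Qed.

Lemma opnorm_bound_analysis_on (T : (I -> scalars R k) -> H) g x s : uniq s ->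
  (forall a c, supported_on s c -> T (fun i => a * c i) = a *: T c) ->
  ((hnorm (T (analysis_on g x s)))%:E
    <= opnorm T * (Num.sqrt (energy g x s))%:E)%E.
Proof.
move=> us TZ.
have -> : energy g x s = \sum_(i <- s) modulus (analysis_on g x s i) ^+ 2.
  by apply: eq_big_seq => i si; rewrite /analysis_on si.
apply: opnorm_bound => // [|a]; first exact: analysis_on_supported.
exact/TZ/analysis_on_supported.
Qed.

(** The sum on the left is T_G applied to [analysis_on g x s]: this is what
    turns bounds on operators into bounds on energies. *)
Lemma inner_frame_operator g x s :
  '[x, \sum_(i <- s) '[x, g i] *: g i] = \sum_(i <- s) `|'[x, g i]| ^+ 2.
Proof.
rewrite inner_sumr; apply: eq_bigr => i _.
by rewrite innerZr mulrC mul_conjugate.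
Qed.

Lemma modulus_sum_sqr_energy g x s :
  modulus (\sum_(i <- s) `|'[x, g i]| ^+ 2) = energy g x s.
Proof.
rewrite modulus_sum => [|i]; last by rewrite exprn_ge0.
by apply: eq_bigr => i _; rewrite modulusX2 modulus_normr.
Qed.

(** With N the square root of the energy, N^2 = <x, T_G a> <= |x| |T_G| N, where
    a has norm N; then N cancels, unless it vanishes. *)
Lemma energy_le_opnorm g x s : uniq s ->
  ((Num.sqrt (energy g x s))%:E <= opnorm (synthesis g) * (hnorm x)%:E)%E.
Proof.
move=> us; set N := Num.sqrt _.
have : 0 <= N by exact: sqrtr_ge0.
rewrite le_eqVlt => /predU1P[<-|N_gt0].
  by rewrite mule_ge0 ?opnorm_ge0 // lee_fin hnorm_ge0.
rewrite -(@lee_pmul2l _ N%:E) // -EFinM -expr2 sqr_sqrtr ?energy_ge0 //.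
apply: (@le_trans _ _
    ((hnorm x)%:E * (hnorm (synthesis g (analysis_on g x s)))%:E)%E).
  rewrite -EFinM lee_fin -modulus_sum_sqr_energy -inner_frame_operator.
  rewrite synthesis_analysis_on //.
  exact: CauchySchwarz_hnorm.
rewrite [leRHS]muleC (muleC (opnorm _)) -muleA lee_wpmul2l //; last first.
  by apply: opnorm_bound_analysis_on => // a c; exact: synthesisZ.
by rewrite lee_fin hnorm_ge0.
Qed.

(** Termwise, |a|^2 - |b|^2 = conj(a) (a - b) + conj(conj(b) (a - b)), and a - b
    is the coefficient of x along g_i - h_i. *)
Lemma energy_perturbation g h x s (D := synthesis g \- synthesis h) :
  uniq s ->
  energy g x s - energy h x s
    <= hnorm x * (hnorm (D (analysis_on g x s)) + hnorm (D (analysis_on h x s))).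
Proof.
move=> us.
have DE f : D (analysis_on f x s) = \sum_(i <- s) '[x, f i] *: (g i - h i).
  rewrite /D /= !synthesis_analysis_on // -sumrB.
  by apply: eq_bigr => i _; rewrite scalerBr.
have : \sum_(i <- s) `|'[x, g i]| ^+ 2 =
    \sum_(i <- s) `|'[x, h i]| ^+ 2
      + ('[x, D (analysis_on g x s)] + conjugate '[x, D (analysis_on h x s)]).
  rewrite !DE !inner_sumr rmorph_sum -!big_split; apply: eq_bigr => i _ /=.
  rewrite !innerZr innerBr rmorphM rmorphB /= conjugateK -!mul_conjugate.
  by ring.
move=> /(congr1 (@modulus R k)); rewrite modulus_sum_sqr_energy lerBlDl => ->.
apply: le_trans (ler_modulusD _ _) _; rewrite modulus_sum_sqr_energy lerD2l.
apply: le_trans (ler_modulusD _ _) _; rewrite modulus_conjugate mulrDr.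
by rewrite lerD ?CauchySchwarz_hnorm.
Qed.

(** The inequalities are between extended reals, so that an infinite operator
    norm needs no separate treatment. *)
Lemma energy_sub_le_opnorm g h x s : uniq s ->
  ((energy g x s - energy h x s)%:E <=
   (opnorm (synthesis g) + opnorm (synthesis h))
     * opnorm (synthesis g \- synthesis h)%R * (hnorm x ^+ 2)%:E)%E.
Proof.
move=> us; set p := (_ + _)%E; set d := opnorm (_ \- _).
have p0 : (0 <= p)%E by rewrite adde_ge0 ?opnorm_ge0.
have d0 : (0 <= d)%E by exact: opnorm_ge0.
have x0 : (0 <= (hnorm x)%:E)%E by rewrite lee_fin hnorm_ge0.
have DZ a c : supported_on s c ->
    (synthesis g \- synthesis h) (fun i => a * c i)
      = a *: (synthesis g \- synthesis h) c.
  by move=> cs; rewrite /= !(synthesisZ _ _ us cs) scalerBr.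
have Dle f : ((hnorm ((synthesis g \- synthesis h) (analysis_on f x s)))%:E <=
    d * (opnorm (synthesis f) * (hnorm x)%:E))%E.
  apply: le_trans (opnorm_bound_analysis_on _ _ us DZ) _.
  by rewrite lee_wpmul2l // energy_le_opnorm.
apply: (@le_trans _ _ ((hnorm x)%:E * (d * (p * (hnorm x)%:E)))%E).
  apply: le_trans (_ : _ <= (hnorm x * _)%:E)%E _.
    by rewrite lee_fin; exact: energy_perturbation.
  rewrite EFinM lee_wpmul2l // EFinD.
  rewrite /p ge0_muleDl ?opnorm_ge0 // ge0_muleDr ?mule_ge0 ?opnorm_ge0 //.
  by rewrite leeD.
by rewrite expr2 EFinM (muleCA d) (muleCA _ p) (muleCA _ d) muleA lexx.
Qed.

(** * Frame bounds of weavings *)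

(** Instead of projecting x onto the closed span, test the hypothesis on the
    vector y = \sum_(i <- s) <x, h_i> h_i of the span, for which S = <x, y>,
    where S is the energy of x.  Expanding <y, y> gives |y|^2 <= B S, hence
    S^2 <= |x|^2 |y|^2 <= B S |x|^2. *)
Lemma bessel_of_closed_span h B : 0 < B ->
  (forall y s, closed_span h y -> uniq s -> energy h y s <= B * hnorm y ^+ 2) ->
  forall x s, uniq s -> energy h x s <= B * hnorm x ^+ 2.
Proof.
move=> B0 bB x s us; pose y := \sum_(i <- s) '[x, h i] *: h i.
set S := energy h x s.
have y_span : closed_span h y.
  by apply: subset_closure; exists s, (fun i => '[x, h i]).
have y_le : hnorm y ^+ 2 <= B * S.
  have : (B * 2) * hnorm y ^+ 2 <= B ^+ 2 * S + energy h y s.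
    rewrite hnorm_sqr {2}/y inner_sumr.
    apply: (@le_trans _ _ (B * 2 *
      \sum_(i <- s) modulus '[x, h i] * modulus '[y, h i])).
      rewrite ler_pM2l ?mulr_gt0 //; apply: le_trans (ler_modulus_sum _ _) _.
      by apply: ler_sum => i _; rewrite innerZr modulusM modulus_conjugate.
    rewrite /S /energy !mulr_sumr -big_split; apply: ler_sum => i _ /=.
    set u := modulus _; set v := modulus _.
    (* The weight B makes the energy of y cost only half of 2 B |y|^2. *)
    by have := sqr_ge0 (B * u - v); nra.
  by have := bB y s y_span us; nra.
have S_le : S <= hnorm x * hnorm y.
  by rewrite /S -modulus_sum_sqr_energy -inner_frame_operator CauchySchwarz_hnorm.
have : 0 <= S by exact: energy_ge0.
rewrite le_eqVlt => /predU1P[<-|S0].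
  by rewrite mulr_ge0 ?exprn_ge0 ?hnorm_ge0 ?ltW.
have : S ^+ 2 <= hnorm x ^+ 2 * (B * S).
  apply: le_trans (_ : (hnorm x * hnorm y) ^+ 2 <= _).
    by rewrite ler_pXn2r ?nnegrE ?mulr_ge0 ?hnorm_ge0 ?(ltW S0).
  by rewrite exprMn ler_wpM2l ?exprn_ge0 ?hnorm_ge0.
by rewrite mulrA expr2 ler_pM2r // mulrC.
Qed.

Lemma frame_sequence_bessel h : frame_sequence h ->
  exists2 B, 0 < B & forall x,
    (\esum_(i in [set: I]) (modulus '[x, h i] ^+ 2)%:E
      <= (B * hnorm x ^+ 2)%:E)%E.
Proof.
move=> [_ [A [B [_ B0 bAB]]]]; exists B => // x; apply: esum_fin_le => s us.
rewrite lee_fin; apply: bessel_of_closed_span => // y r hy ur.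
have /andP[_ yB] := bAB y hy; rewrite -lee_fin; apply: le_trans yB.
exact: fin_le_esum.
Qed.

(** On a finite set of indices the two weavings differ only outside sigma, where
    their energies are those of g and h. *)
Lemma weaving_energy_le sigma f g h x :
  (\esum_(i in [set: I]) (modulus '[x, weaving sigma f g i] ^+ 2)%:E
   <= \esum_(i in [set: I]) (modulus '[x, weaving sigma f h i] ^+ 2)%:E +
      (opnorm (synthesis g) + opnorm (synthesis h))
        * opnorm (synthesis g \- synthesis h)%R * (hnorm x ^+ 2)%:E)%E.
Proof.
apply: esum_fin_le => s us; pose r := [seq i <- s | i \notin sigma].
have on_s u : \sum_(i <- s) modulus '[x, weaving sigma f u i] ^+ 2 =
    energy f x [seq i <- s | i \in sigma] + energy u x r.
  rewrite (bigID (mem sigma)) /energy !big_filter /=; congr (_ + _).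
    by apply: eq_bigr => i si; rewrite /weaving si.
  by apply: eq_bigr => i /negPf si; rewrite /weaving si.
apply: (@le_trans _ _ (\sum_(i <- s) modulus '[x, weaving sigma f h i] ^+ 2
    + (energy g x r - energy h x r))%:E).
  by rewrite lee_fin !on_s; lra.
by rewrite EFinD leeD ?fin_le_esum ?energy_sub_le_opnorm ?filter_uniq.
Qed.

Lemma weaving_bessel sigma f h C D :
    (forall x, (\esum_(i in [set: I]) (modulus '[x, f i] ^+ 2)%:E
      <= (C * hnorm x ^+ 2)%:E)%E) ->
    (forall x, (\esum_(i in [set: I]) (modulus '[x, h i] ^+ 2)%:E
      <= (D * hnorm x ^+ 2)%:E)%E) ->
  forall x, (\esum_(i in [set: I]) (modulus '[x, weaving sigma f h i] ^+ 2)%:E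
    <= ((C + D) * hnorm x ^+ 2)%:E)%E.
Proof.
have sqr0 (z : scalars R k) : (0 <= (modulus z ^+ 2)%:E)%E.
  by rewrite lee_fin exprn_ge0 ?modulus_ge0.
move=> fC hD x; rewrite mulrDl EFinD; apply: le_trans (leeD (fC x) (hD x)).
rewrite -esumD //; apply: le_esum => i _; rewrite /weaving.
by case: ifP => _; rewrite ?leeDl ?leeDr.
Qed.

End Frames.

Theorem theorem4p6 (R : realType) (k : scalar_kind) (H : hilbertSpace R k)
    (Hsep : separable H) (I : countType) (f g h : I -> H) (A B : R)
    (Ff : frame f) (Fg : frame g) (Wfg : woven f g)
    (bAB : universal_frame_bounds f g A B)
    (Sh : frame_sequence h)
    (small : ((opnorm (synthesis g) + opnorm (synthesis h))
                * opnorm (synthesis g \- synthesis h)%R < A%:E)%E) :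
  woven f h.
Proof.
have [Sf _ _] := Wfg; split=> // sigma; split=> //.
set e := (_ * _)%E in small.
have e_ge0 : (0 <= e)%E by rewrite mule_ge0 ?adde_ge0 ?opnorm_ge0.
have e_fin : e \is a fin_num by rewrite ge0_fin_numE // (lt_trans small) ?ltry.
have eA : fine e < A by rewrite -lte_fin fineK.
have [C C0 fC] := frame_sequence_bessel Sf.
have [D D0 hD] := frame_sequence_bessel Sh.
have [_ _ bfg] := bAB sigma.
exists (A - fine e), (C + D); split; rewrite ?subr_gt0 ?addr_gt0 // => x _.
rewrite (weaving_bessel sigma fC hD) andbT.
have /andP[Ax _] := bfg x Logic.I.
rewrite mulrBl EFinB leeBlDr // (EFinM (fine e)) fineK //.
exact: le_trans Ax (weaving_energy_le _ _ _ _ _).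
Qed.
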